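(* Let $\mathfrak{g}$ be the 4-dimensional real Lie algebra with basis $\{e_1,e_2,e_3,e_4\}$ whose nonzero brackets of basis vectors are determined (up to antisymmetry) by $$[e_2,e_4]=e_3,\qquad [e_4,e_3]=e_2,\qquad [e_3,e_2]=e_4,$$ and let $(G,H,g)$, $H=(J_1,J_2,J_3)$, be the corresponding Lie group equipped with the standard left-invariant structure $(J_1,J_2,J_3,g)$ described in the context. Then $(G,H,g)$ belongs to the class $$\mathcal{H}=\mathcal{W}_4(J_1)\cap(\mathcal{W}_1\oplus\mathcal{W}_2)(J_2)\cap(\mathcal{W}_1\oplus\mathcal{W}_2)(J_3)$$ of hypercomplex manifolds with Hermitian-Norden metrics, and, for each $\alpha\in\{2,3\}$, it belongs neither to $\mathcal{W}_1(J_\alpha)$ nor to $\mathcal{W}_2(J_\alpha)$.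
   Context: Standard structure: given a 4-dimensional real Lie algebra $\mathfrak{g}$ with a fixed basis $\{e_1,e_2,e_3,e_4\}$, let $G$ be the simply connected Lie group with Lie algebra $\mathfrak{g}$, and regard elements of $\mathfrak{g}$ as left-invariant vector fields on $G$. Define left-invariant endomorphisms $$J_1e_1=e_2,\ J_1e_2=-e_1,\ J_1e_3=-e_4,\ J_1e_4=e_3;$$ $$J_2e_1=e_3,\ J_2e_2=e_4,\ J_2e_3=-e_1,\ J_2e_4=-e_2;$$ $$J_3e_1=-e_4,\ J_3e_2=e_3,\ J_3e_3=-e_2,\ J_3e_4=e_1,$$ and the left-invariant neutral metric $g$ with $g(x,y)=x^1y^1+x^2y^2-x^3y^3-x^4y^4$ for $x=\sum x^ie_i$, $y=\sum y^ie_i$. Then $g(x,y)=\varepsilon_\alpha g(J_\alpha x,J_\alpha y)$ with $\varepsilon_1=1$, $\varepsilon_2=\varepsilon_3=-1$. Structure tensors: let $\nabla$ be the Levi-Civita connection of $g$. For $\alpha=1,2,3$ put $F_\alpha(x,y,z)=g((\nabla_xJ_\alpha)y,z)$ and $\theta_\alpha(z)=g^{ij}F_\alpha(e_i,e_j,z)$, where $(g^{ij})$ is the inverse matrix of $(g(e_i,e_j))$ (summation convention). Classes (dimension 4; conditions are for all $x,y,z$; $\mathfrak{S}_{x,y,z}$ is the cyclic sum): - $\mathcal{W}_4(J_1)$: $F_1(x,y,z)=\frac12\{g(x,y)\theta_1(z)-g(x,z)\theta_1(y)-g(x,J_1y)\theta_1(J_1z)+g(x,J_1z)\theta_1(J_1y)\}$.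 - $\mathcal{W}_1(J_\alpha)$, $\alpha=2,3$: $F_\alpha(x,y,z)=\frac14\{g(x,y)\theta_\alpha(z)+g(x,z)\theta_\alpha(y)+g(x,J_\alpha y)\theta_\alpha(J_\alpha z)+g(x,J_\alpha z)\theta_\alpha(J_\alpha y)\}$. - $\mathcal{W}_2(J_\alpha)$, $\alpha=2,3$: $\mathfrak{S}_{x,y,z}F_\alpha(x,y,J_\alpha z)=0$ and $\theta_\alpha=0$. - $(\mathcal{W}_1\oplus\mathcal{W}_2)(J_\alpha)$, $\alpha=2,3$: the class of complex manifolds with Norden metric, i.e. the Nijenhuis tensor $N_\alpha(x,y)=[J_\alpha x,J_\alpha y]-J_\alpha[J_\alpha x,y]-J_\alpha[x,J_\alpha y]-[x,y]$ vanishes. *)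

(* Defs.v *)
From mathcomp Require Import all_boot all_order all_algebra.
From mathcomp Require Import all_classical all_reals all_analysis.
From mathcomp Require Import ring.

Set Implicit Arguments.
Unset Strict Implicit.
Unset Printing Implicit Defensive.

Import Order.TTheory GRing.Theory Num.Theory.
Import numFieldNormedType.Exports.

Local Open Scope classical_set_scope.
Local Open Scope ring_scope.

(** * Smooth manifolds and Lie groups *)

Section SmoothFunctions.
Context {R : realType} {n : nat}.

(* [U] is meant to be open: the values of [f] outside [U] are irrelevant. *)
Fixpoint Ck_on (k : nat) (U : set 'rV[R]_n) (f : 'rV[R]_n -> R) : Prop :=
  (forall v, U v -> {for v, continuous f}) /\
  (if k is k'.+1 then
     forall i : 'I_n,
       (forall v, U v -> derivable f v (delta_mx 0 i)) /\
       Ck_on k' U (fun v => 'D_(delta_mx 0 i) f v)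
   else True).

Definition smooth_on (U : set 'rV[R]_n) (f : 'rV[R]_n -> R) : Prop :=
  forall k, Ck_on k U f.

End SmoothFunctions.

(* [chart_map] is a homeomorphism from the open set [chart_dom] onto an open
   subset of R^n, with inverse [chart_inv]; both maps are totalized. *)
Record chart (R : realType) (n : nat) (M : topologicalType) := Chart {
  chart_dom : set M;
  chart_map : M -> 'rV[R]_n;
  chart_inv : 'rV[R]_n -> M;
  chart_dom_open : open chart_dom;
  chart_im_open : open (chart_map @` chart_dom);
  chart_mapK : forall p, chart_dom p -> chart_inv (chart_map p) = p;
  chart_map_cont : forall p, chart_dom p -> {for p, continuous chart_map};
  chart_inv_cont : forall v, (chart_map @` chart_dom) v ->
    {for v, continuous chart_inv}
}.

Definition chart_im (R : realType) (n : nat) (M : topologicalType)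
  (c : chart R n M) : set 'rV[R]_n := chart_map c @` chart_dom c.

(* Smoothness of the group operations is expressed in charts; for the product,
   a point of R^(n + n) is read as a pair of points of R^n. *)
Record lieGroup (R : realType) (n : nat) := LieGroup {
  lie_sort :> topologicalType;
  lie_hausdorff : hausdorff_space lie_sort;
  lie_second_countable : @second_countable lie_sort;
  atlas : set (chart R n lie_sort);
  atlas_cover : forall p, exists2 c, atlas c & chart_dom c p;
  atlas_compat : forall c d, atlas c -> atlas d -> forall i : 'I_n,
    smooth_on [set v | chart_im c v /\ chart_dom d (chart_inv c v)]
      (fun v => chart_map d (chart_inv c v) 0 i);
  lie_mul : lie_sort -> lie_sort -> lie_sort;
  lie_one : lie_sort;
  lie_inv : lie_sort -> lie_sort;
  lie_mulA : associative lie_mul;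
  lie_mul1g : left_id lie_one lie_mul;
  lie_mulVg : left_inverse lie_one lie_inv lie_mul;
  lie_mul_cont : continuous (fun p : lie_sort * lie_sort => lie_mul p.1 p.2);
  lie_mul_smooth : forall b c d, atlas b -> atlas c -> atlas d ->
    forall i : 'I_n,
    smooth_on [set w : 'rV[R]_(n + n) |
                [/\ chart_im b (lsubmx w), chart_im c (rsubmx w) &
                  chart_dom d (lie_mul (chart_inv b (lsubmx w))
                                       (chart_inv c (rsubmx w)))]]
      (fun w => chart_map d (lie_mul (chart_inv b (lsubmx w))
                                     (chart_inv c (rsubmx w))) 0 i);
  lie_inv_cont : continuous lie_inv;
  lie_inv_smooth : forall c d, atlas c -> atlas d -> forall i : 'I_n,
    smooth_on [set v | chart_im c v /\ chart_dom d (lie_inv (chart_inv c v))]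
      (fun v => chart_map d (lie_inv (chart_inv c v)) 0 i)
}.

Definition simply_connected (R : realType) (T : topologicalType) : Prop :=
  (forall x y : T, exists gamma : R -> T,
     [/\ {within `[0, 1], continuous gamma}, gamma 0 = x & gamma 1 = y]) /\
  (forall (x : T) (gamma : R -> T),
     {within `[0, 1], continuous gamma} -> gamma 0 = x -> gamma 1 = x ->
     exists H : R * R -> T,
       [/\ {within `[0, 1] `*` `[0, 1], continuous H},
           forall t, t \in `[0, 1] -> H (0, t) = gamma t,
           forall t, t \in `[0, 1] -> H (1, t) = x &
           forall s, s \in `[0, 1] -> H (s, 0) = x /\ H (s, 1) = x]).

(** * Left-invariant vector fields *)

Section LieAlgebraOfGroup.
Context {R : realType} {n : nat} (G : lieGroup R n).

(* C^oo(G) *)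
Definition smooth (f : G -> R) : Prop :=
  forall c, atlas c -> smooth_on (chart_im c) (f \o chart_inv c).

(* Vector fields as derivations of C^oo(G); the values of [X] on functions that
   are not smooth are irrelevant. *)
Record is_derivation (X : (G -> R) -> (G -> R)) : Prop := IsDerivation {
  deriv_smooth : forall f, smooth f -> smooth (X f);
  deriv_linear : forall (a : R) f h, smooth f -> smooth h -> forall p,
    X (fun q => a * f q + h q) p = a * X f p + X h p;
  deriv_leibniz : forall f h, smooth f -> smooth h -> forall p,
    X (fun q => f q * h q) p = X f p * h p + f p * X h p
}.

Definition left_invariant (X : (G -> R) -> (G -> R)) : Prop :=
  forall (a : G) f, smooth f -> forall p,
    X (fun q => f (lie_mul a q)) p = X f (lie_mul a p).

Record is_lie_bracket (br : 'rV[R]_n -> 'rV[R]_n -> 'rV[R]_n) : Prop :=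
  IsLieBracket {
  br_linear : forall a x y z, br (a *: x + y) z = a *: br x z + br y z;
  br_alt : forall x, br x x = 0;
  br_jacobi : forall x y z,
    br x (br y z) + br y (br z x) + br z (br x y) = 0
}.

(* [iota] is an isomorphism from the Lie algebra (R^n, br) onto the Lie algebra
   of left-invariant vector fields on G. *)
Record is_lie_algebra_of (br : 'rV[R]_n -> 'rV[R]_n -> 'rV[R]_n)
    (iota : 'rV[R]_n -> (G -> R) -> (G -> R)) : Prop := IsLieAlgebraOf {
  iota_deriv : forall v, is_derivation (iota v);
  iota_left_invariant : forall v, left_invariant (iota v);
  iota_linear : forall a v w f, smooth f -> forall p,
    iota (a *: v + w) f p = a * iota v f p + iota w f p;
  iota_bracket : forall v w f, smooth f -> forall p,
    iota (br v w) f p = iota v (iota w f) p - iota w (iota v f) p;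
  iota_inj : forall v, (forall f, smooth f -> forall p, iota v f p = 0) ->
    v = 0;
  iota_surj : forall X, is_derivation X -> left_invariant X ->
    exists v, forall f, smooth f -> forall p, X f p = iota v f p
}.

End LieAlgebraOfGroup.

(** * The standard structure on a 4-dimensional Lie algebra *)

Definition i1 : 'I_4 := @Ordinal 4 0 isT.
Definition i2 : 'I_4 := @Ordinal 4 1 isT.
Definition i3 : 'I_4 := @Ordinal 4 2 isT.
Definition i4 : 'I_4 := @Ordinal 4 3 isT.

Section StandardStructure.
Context {R : realType}.
Implicit Types x y : 'rV[R]_4.

Definition e (i : 'I_4) : 'rV[R]_4 := delta_mx 0 i.

Definition J1 x : 'rV[R]_4 :=
  x 0 i1 *: e i2 - x 0 i2 *: e i1 - x 0 i3 *: e i4 + x 0 i4 *: e i3.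
Definition J2 x : 'rV[R]_4 :=
  x 0 i1 *: e i3 + x 0 i2 *: e i4 - x 0 i3 *: e i1 - x 0 i4 *: e i2.
Definition J3 x : 'rV[R]_4 :=
  - (x 0 i1 *: e i4) + x 0 i2 *: e i3 - x 0 i3 *: e i2 + x 0 i4 *: e i1.

Definition g x y : R :=
  x 0 i1 * y 0 i1 + x 0 i2 * y 0 i2 - x 0 i3 * y 0 i3 - x 0 i4 * y 0 i4.

Lemma J_quaternionic x :
  [/\ J1 (J1 x) = - x, J2 (J2 x) = - x, J3 (J3 x) = - x,
      J1 (J2 x) = J3 x & J2 (J1 x) = - J3 x].
Proof.
have ordE (i : 'I_4) : [\/ i = i1, i = i2, i = i3 | i = i4].
  case: i => [[|[|[|[|//]]]] lti];
    [constructor 1 | constructor 2 | constructor 3 | constructor 4];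
    exact: val_inj.
by split; apply/rowP => i; case: (ordE i) => ->; rewrite !mxE /=; ring.
Qed.

Lemma g_hermitian_norden x y :
  [/\ g x y = g (J1 x) (J1 y), g x y = - g (J2 x) (J2 y) &
      g x y = - g (J3 x) (J3 y)].
Proof. by split; rewrite /g !mxE /=; ring. Qed.

Definition gram : 'M[R]_4 := \matrix_(i, j) g (e i) (e j).

End StandardStructure.

(** * Connections and structure tensors *)

(* Left-invariant vector fields trivialize TG: through [iota], a vector field
   is a map [x : G -> 'rV_4] giving the components of its values in the frame
   e_1, ..., e_4.  Elements of the Lie algebra are the constant maps, and
   left-invariant tensors such as J_alpha and g act pointwise. *)
Section Geometry.
Context {R : realType} (G : lieGroup R 4).
Variable br : 'rV[R]_4 -> 'rV[R]_4 -> 'rV[R]_4.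
Variable iota : 'rV[R]_4 -> (G -> R) -> (G -> R).

Definition field := G -> 'rV[R]_4.
Implicit Types x y z : field.

Definition smooth_field x : Prop := forall k, smooth (fun p => x p 0 k).

Definition act x (f : G -> R) : G -> R := fun p => iota (x p) f p.

(* [sum_i x^i e_i, sum_j y^j e_j], expanded by the Leibniz rule *)
Definition vbracket x y : field := fun p =>
  br (x p) (y p) +
  \row_k (act x (fun q => y q 0 k) p - act y (fun q => x q 0 k) p).

Record is_levi_civita (nabla : field -> field -> field) : Prop :=
  IsLeviCivita {
  nabla_smooth : forall x y, smooth_field x -> smooth_field y ->
    smooth_field (nabla x y);
  nabla_addl : forall x x' y,
    smooth_field x -> smooth_field x' -> smooth_field y -> forall p,
    nabla (fun q => x q + x' q) y p = nabla x y p + nabla x' y p;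
  nabla_scalel : forall f x y,
    smooth f -> smooth_field x -> smooth_field y -> forall p,
    nabla (fun q => f q *: x q) y p = f p *: nabla x y p;
  nabla_addr : forall x y y',
    smooth_field x -> smooth_field y -> smooth_field y' -> forall p,
    nabla x (fun q => y q + y' q) p = nabla x y p + nabla x y' p;
  nabla_leibniz : forall x f y,
    smooth_field x -> smooth f -> smooth_field y -> forall p,
    nabla x (fun q => f q *: y q) p = act x f p *: y p + f p *: nabla x y p;
  nabla_torsion_free : forall x y, smooth_field x -> smooth_field y ->
    forall p, nabla x y p - nabla y x p = vbracket x y p;
  nabla_metric : forall x y z,
    smooth_field x -> smooth_field y -> smooth_field z -> forall p,
    act x (fun q => g (y q) (z q)) p =
      g (nabla x y p) (z p) + g (y p) (nabla x z p)
}.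

Variable nabla : field -> field -> field.
Variable J : 'rV[R]_4 -> 'rV[R]_4.

Definition F x y z : G -> R := fun p =>
  g (nabla x (J \o y) p - J (nabla x y p)) (z p).

Definition theta z : G -> R := fun p =>
  \sum_(i < 4) \sum_(j < 4)
    invmx gram i j * F (fun _ => e i) (fun _ => e j) z p.

Definition W4 : Prop := forall x y z,
  smooth_field x -> smooth_field y -> smooth_field z -> forall p,
  F x y z p = 2^-1 *
    (g (x p) (y p) * theta z p - g (x p) (z p) * theta y p
     - g (x p) (J (y p)) * theta (J \o z) p
     + g (x p) (J (z p)) * theta (J \o y) p).

Definition W1 : Prop := forall x y z,
  smooth_field x -> smooth_field y -> smooth_field z -> forall p,
  F x y z p = 4^-1 *
    (g (x p) (y p) * theta z p + g (x p) (z p) * theta y p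
     + g (x p) (J (y p)) * theta (J \o z) p
     + g (x p) (J (z p)) * theta (J \o y) p).

Definition W2 : Prop :=
  (forall x y z,
     smooth_field x -> smooth_field y -> smooth_field z -> forall p,
     F x y (J \o z) p + F y z (J \o x) p + F z x (J \o y) p = 0) /\
  (forall z, smooth_field z -> forall p, theta z p = 0).

Definition nijenhuis x y : field := fun p =>
  vbracket (J \o x) (J \o y) p - J (vbracket (J \o x) y p)
  - J (vbracket x (J \o y) p) - vbracket x y p.

Definition W1_plus_W2 : Prop := forall x y,
  smooth_field x -> smooth_field y -> forall p, nijenhuis x y p = 0.

End Geometry.

Definition class_H (R : realType) (G : lieGroup R 4)
    (br : 'rV[R]_4 -> 'rV[R]_4 -> 'rV[R]_4)
    (iota : 'rV[R]_4 -> (G -> R) -> (G -> R))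
    (nabla : field G -> field G -> field G) : Prop :=
  [/\ W4 nabla J1, W1_plus_W2 br iota J2 & W1_plus_W2 br iota J3].

(* Main.v *)
Require Import Defs.
From mathcomp Require Import all_boot all_order all_algebra.
From mathcomp Require Import all_classical all_reals all_analysis.
From mathcomp Require Import ring lra.

Set Implicit Arguments.
Unset Strict Implicit.
Unset Printing Implicit Defensive.

Import Order.TTheory GRing.Theory Num.Theory.
Import numFieldNormedType.Exports.

Local Open Scope classical_set_scope.
Local Open Scope ring_scope.

(* Left-invariant fields have constant metric products, so Koszul's formula
   gives the Levi-Civita connection on them as an explicit bilinear map in terms
   of the bracket.  The tensors F_alpha and N_alpha are C^oo(G)-linear, hence at
   a point they depend only on the values of their arguments there, and every
   class condition becomes a polynomial identity in coordinates.  With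
   theta_2 = - 2 e^3 and theta_3 = 2 e^4, W_2 fails because the Lee forms do not
   vanish; W_1 fails because F_2(e_2, e_1, e_4) = F_3(e_2, e_1, e_3) = 3/2 while
   the right-hand sides are 1/2. *)

(** * Functions of class C^k on open subsets of R^n *)

Section SmoothFunctionFacts.
Context {R : realType} {n : nat}.
Implicit Types (U : set 'rV[R]_n) (f h : 'rV[R]_n -> R).

(** Since [U] is open, agreement on [U] is agreement near each of its points, so continuity and
    partial derivatives transfer. This is needed because derivation rules hold only at the points of
    [U], not as equalities of functions. *)
Lemma eq_Ck_on k U f h :
  open U -> {in U, f =1 h} -> Ck_on k U f -> Ck_on k U h.
Proof.
move=> oU; elim: k f h => [|k IHk] f h fh [cf df].
  split=> // v Uv; have fhv : {near nbhs v, f =1 h}.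
    by apply: filterS (open_nbhs_nbhs (conj oU Uv)) => w Uw; apply/fh/mem_set.
  change (h @ v --> h v); rewrite -(nbhs_singleton fhv).
  exact: cvg_trans (near_eq_cvg fhv) (cf v Uv).
have fhv v : U v -> {near nbhs v, f =1 h}.
  move=> Uv.
  by apply: filterS (open_nbhs_nbhs (conj oU Uv)) => w Uw; apply/fh/mem_set.
split=> [v Uv|i].
  change (h @ v --> h v); rewrite -(nbhs_singleton (fhv v Uv)).
  exact: cvg_trans (near_eq_cvg (fhv v Uv)) (cf v Uv).
have [dfi Ckf] := df i; split=> [v Uv|].
  exact: near_eq_derivable (fhv v Uv) (dfi v Uv).
apply: IHk Ckf => v /set_mem Uv.
exact: near_eq_derive (fhv v Uv).
Qed.

Lemma Ck_on_cst k U (c : R) : Ck_on k U (fun=> c).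
Proof.
elim: k c => [|k IHk] c; first by split=> [v _|//]; apply: cst_continuous.
split=> [v _|i]; first exact: cst_continuous.
split=> [v _|]; first exact: derivable_cst.
have -> : 'D_(delta_mx 0 i) (fun _ : 'rV[R]_n => c) = fun=> 0.
  by apply/funext => v; apply: derive_cst.
exact: IHk.
Qed.

Lemma Ck_onN k U f : open U -> Ck_on k U f -> Ck_on k U (fun v => - f v).
Proof.
move=> oU; elim: k f => [|k IHk] f [cf df].
  by split=> [v Uv|//]; apply: continuousN; apply: cf.
split=> [v Uv|i]; first by apply: continuousN; apply: cf.
have [dfi Ckf] := df i; split=> [v Uv|]; first exact: derivableN (dfi v Uv).
apply: eq_Ck_on oU _ (IHk _ Ckf) => v /set_mem Uv.
by rewrite -deriveN //; apply: dfi.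
Qed.

End SmoothFunctionFacts.

(** * Smooth functions on the group and their derivations *)

Section LieGroupFunctions.
Context {R : realType} {n : nat} (G : lieGroup R n).
Implicit Types f h : G -> R.

Lemma smooth_cst (c : R) : smooth (fun _ : G => c).
Proof. by move=> d _ k; apply: Ck_on_cst. Qed.

Lemma smoothN f : smooth f -> smooth (fun q => - f q).
Proof.
by move=> sf d ad k; apply: Ck_onN (sf d ad k); apply: chart_im_open.
Qed.

(** Leibniz applied to 1 * 1 gives X 1 = X 1 + X 1, hence X 1 = 0; linearity does the rest. *)
Lemma derivation_cst (X : (G -> R) -> (G -> R)) (c : R) p :
  is_derivation X -> X (fun=> c) p = 0.
Proof.
move=> dX.
have s c' : smooth (fun _ : G => c') by apply: smooth_cst.
have X0 : X (fun=> 0) p = 0.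
  have := deriv_linear dX 1 (s 0) (s 0) p.
  rewrite mul1r addr0 mul1r => /eqP.
  by rewrite -subr_eq subrr eq_sym => /eqP.
have X1 : X (fun=> 1) p = 0.
  have := deriv_leibniz dX (s 1) (s 1) p.
  rewrite !mulr1 mul1r => /eqP.
  by rewrite -subr_eq subrr eq_sym => /eqP.
have := deriv_linear dX c (s 1) (s 0) p.
by rewrite mulr1 addr0 X0 X1 mulr0 addr0.
Qed.

Lemma derivationN (X : (G -> R) -> (G -> R)) f p :
  is_derivation X -> smooth f -> X (fun q => - f q) p = - X f p.
Proof.
move=> dX sf; have := deriv_linear dX (-1) sf (smooth_cst 0) p.
rewrite (derivation_cst _ _ dX) addr0 mulN1r => <-.
by congr (X _ p); apply/funext => q; rewrite mulN1r addr0.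
Qed.

End LieGroupFunctions.

(** * Linear algebra in the frame e_1, ..., e_4 *)

Section Frame.
Context {R : realType}.
Implicit Types u v : 'rV[R]_4.

Lemma ord4P (i : 'I_4) : [\/ i = i1, i = i2, i = i3 | i = i4].
Proof.
by case: i => [[|[|[|[|//]]]] lti];
  [constructor 1 | constructor 2 | constructor 3 | constructor 4];
  apply: val_inj.
Qed.

Lemma row4P u v :
  u 0 i1 = v 0 i1 -> u 0 i2 = v 0 i2 -> u 0 i3 = v 0 i3 -> u 0 i4 = v 0 i4 ->
  u = v.
Proof. by move=> *; apply/rowP => i; case: (ord4P i) => ->. Qed.

Lemma sum4 (V : nmodType) (h : 'I_4 -> V) :
  \sum_(i < 4) h i = h i1 + (h i2 + (h i3 + h i4)).
Proof.
rewrite !big_ord_recl big_ord0 addr0.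
by congr (h _ + (h _ + (h _ + h _))); apply: val_inj.
Qed.

Lemma row4E u :
  u = u 0 i1 *: e i1 + (u 0 i2 *: e i2 + (u 0 i3 *: e i3 + u 0 i4 *: e i4)).
Proof. by apply: row4P; rewrite !mxE /=; ring. Qed.

(** The Gram matrix is diag(1, 1, -1, -1), which squares to the identity. *)
Lemma invmx_gram : invmx (gram : 'M[R]_4) = gram.
Proof.
have gramK : (gram : 'M[R]_4) *m gram = 1%:M.
  apply/matrixP => i j; rewrite mxE sum4 !mxE /g !mxE.
  by case: (ord4P i) => ->; case: (ord4P j) => -> /=; ring.
have [ug _] := mulmx1_unit gramK.
by rewrite -[RHS](mulKmx ug) gramK mulmx1.
Qed.

Lemma rowBE u v k : (u - v) 0 k = u 0 k - v 0 k.
Proof. by rewrite !mxE. Qed.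

Lemma rowB3E u1 u2 u3 u4 k :
  (u1 - u2 - u3 - u4) 0 k = u1 0 k - u2 0 k - u3 0 k - u4 0 k.
Proof. by rewrite !mxE. Qed.

Lemma gC u v : g u v = g v u.
Proof. by rewrite /g; ring. Qed.

Lemma gDl u v w : g (u + v) w = g u w + g v w.
Proof. by rewrite /g !mxE; ring. Qed.

Lemma g_e1 u : g u (e i1) = u 0 i1.
Proof. by rewrite /g !mxE /=; ring. Qed.

Lemma g_e2 u : g u (e i2) = u 0 i2.
Proof. by rewrite /g !mxE /=; ring. Qed.

Lemma g_e3 u : g u (e i3) = - u 0 i3.
Proof. by rewrite /g !mxE /=; ring. Qed.

Lemma g_e4 u : g u (e i4) = - u 0 i4.
Proof. by rewrite /g !mxE /=; ring. Qed.

Lemma trace_gram (h : 'I_4 -> 'I_4 -> R) :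
  \sum_(i < 4) \sum_(j < 4) invmx gram i j * h i j =
  h i1 i1 + h i2 i2 - h i3 i3 - h i4 i4.
Proof. by rewrite invmx_gram !sum4 !mxE /g !mxE /=; ring. Qed.

Lemma J1E u : (J1 u 0 i1 = - u 0 i2) *
  (J1 u 0 i2 = u 0 i1) *
  (J1 u 0 i3 = u 0 i4) *
  (J1 u 0 i4 = - u 0 i3).
Proof. by rewrite !mxE /=; do ![split]; ring. Qed.

Lemma J2E u : (J2 u 0 i1 = - u 0 i3) *
  (J2 u 0 i2 = - u 0 i4) *
  (J2 u 0 i3 = u 0 i1) *
  (J2 u 0 i4 = u 0 i2).
Proof. by rewrite !mxE /=; do ![split]; ring. Qed.

Lemma J3E u : (J3 u 0 i1 = u 0 i4) *
  (J3 u 0 i2 = - u 0 i3) *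
  (J3 u 0 i3 = u 0 i2) *
  (J3 u 0 i4 = - u 0 i1).
Proof. by rewrite !mxE /=; do ![split]; ring. Qed.

(** Each component of [J \o x] is then a single component of [x] up to sign, so its smoothness needs
    only negation, not sums. Linearity of [J] also follows. *)
Definition signed_permutation (J : 'rV[R]_4 -> 'rV[R]_4) : Prop :=
  forall k, exists m,
    (forall u, J u 0 k = u 0 m) \/ (forall u, J u 0 k = - u 0 m).

Lemma signed_permutation_J1 : signed_permutation J1.
Proof.
move=> k; case: (ord4P k) => ->;
  [exists i2; right | exists i1; left | exists i4; left | exists i3; right];
  by move=> u; rewrite J1E.
Qed.

Lemma signed_permutation_J2 : signed_permutation J2.
Proof.
move=> k; case: (ord4P k) => ->;
  [exists i3; right | exists i4; right | exists i1; left | exists i2; left];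
  by move=> u; rewrite J2E.
Qed.

Lemma signed_permutation_J3 : signed_permutation J3.
Proof.
move=> k; case: (ord4P k) => ->;
  [exists i4; left | exists i3; right | exists i2; left | exists i1; right];
  by move=> u; rewrite J3E.
Qed.

Section SignedPermutation.
Context (J : 'rV[R]_4 -> 'rV[R]_4) (spJ : signed_permutation J).

Lemma spermD u v : J (u + v) = J u + J v.
Proof.
apply/rowP => k; rewrite mxE.
by have [m [] Jk] := spJ k; rewrite !Jk mxE // opprD.
Qed.

Lemma spermZ a u : J (a *: u) = a *: J u.
Proof.
apply/rowP => k; rewrite mxE.
by have [m [] Jk] := spJ k; rewrite !Jk mxE // mulrN.
Qed.

Lemma spermN u : J (- u) = - J u.
Proof. by rewrite -scaleN1r spermZ scaleN1r. Qed.

End SignedPermutation.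

End Frame.

(** * Smooth fields and tensoriality *)

Section Fields.
Context {R : realType} (G : lieGroup R 4).
Implicit Types (x y z : field G) (f : G -> R).

Lemma smooth_field_cst (u : 'rV[R]_4) : smooth_field (fun _ : G => u).
Proof. by move=> k; apply: smooth_cst. Qed.

Lemma smooth_field_sperm (J : 'rV[R]_4 -> 'rV[R]_4) x :
  signed_permutation J -> smooth_field x -> smooth_field (J \o x).
Proof.
move=> spJ sx k; have [m [] Jk] := spJ k.
  by rewrite (_ : (fun p => _) = fun p => x p 0 m) //; apply/funext => p /=.
rewrite (_ : (fun p => _) = fun p => - x p 0 m); first exact: smoothN.
by apply/funext => p /=.
Qed.

(* The partial sums of [\sum_k x^k e_k] have this form, so expanding a field in
   the frame does not require smooth functions to be closed under addition. *)
Lemma smooth_field_mask x (P : pred 'I_4) y : smooth_field x ->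
  (forall q k, y q 0 k = if P k then x q 0 k else 0) -> smooth_field y.
Proof.
move=> sx yE k.
rewrite (_ : (fun q => _) = fun q => if P k then x q 0 k else 0).
  by case: (P k); [apply: sx | apply: smooth_cst].
by apply/funext => q.
Qed.

(** Expanding in the frame and pulling the coefficient functions out of [T] leaves only their values
    at [p], which the field and the constant field [x p] share. *)
Lemma tensorial_at (p : G) (T : field G -> 'rV[R]_4) x :
  (forall y z, smooth_field y -> smooth_field z ->
     T (fun q => y q + z q) = T y + T z) ->
  (forall f y, smooth f -> smooth_field y ->
     T (fun q => f q *: y q) = f p *: T y) ->
  smooth_field x -> T x = T (fun=> x p).
Proof.
move=> TD TZ sx.
suff expand y : smooth_field y -> T y =
    y p 0 i1 *: T (fun=> e i1) + (y p 0 i2 *: T (fun=> e i2) +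
      (y p 0 i3 *: T (fun=> e i3) + y p 0 i4 *: T (fun=> e i4))).
  by rewrite (expand x sx) (expand (fun=> x p) (smooth_field_cst (x p))).
move=> sy.
have s1 i : smooth_field (fun q => y q 0 i *: e i).
  apply: (smooth_field_mask (P := pred1 i) sy) => q k; rewrite !mxE /=.
  by rewrite eq_sym; case: eqVneq => [->|_]; rewrite ?mulr1 ?mulr0.
have s2 : smooth_field (fun q => y q 0 i3 *: e i3 + y q 0 i4 *: e i4).
  apply: (smooth_field_mask (P := pred2 i3 i4) sy) => q k; rewrite !mxE /=.
  by case: (ord4P k) => -> /=; ring.
have s3 : smooth_field (fun q =>
    y q 0 i2 *: e i2 + (y q 0 i3 *: e i3 + y q 0 i4 *: e i4)).
  apply: (smooth_field_mask (P := predC1 i1) sy) => q k; rewrite !mxE /=.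
  by case: (ord4P k) => -> /=; ring.
have se i : smooth_field (fun _ : G => e i : 'rV[R]_4).
  exact: smooth_field_cst.
rewrite {1}(_ : y = fun q => y q 0 i1 *: e i1 + (y q 0 i2 *: e i2 +
  (y q 0 i3 *: e i3 + y q 0 i4 *: e i4))); last first.
  by apply/funext => q; apply: row4E.
by rewrite !TD ?TZ.
Qed.

End Fields.

(** * The bracket and its connection in coordinates *)

(** This is R + so(3): e_1 is central, and the rest is the cross product for the ordered basis (e_2,
    e_4, e_3). *)
Definition so3_bracket (R : realType) (u v : 'rV[R]_4) : 'rV[R]_4 :=
  (u 0 i4 * v 0 i3 - u 0 i3 * v 0 i4) *: e i2 +
  (u 0 i2 * v 0 i4 - u 0 i4 * v 0 i2) *: e i3 +
  (u 0 i3 * v 0 i2 - u 0 i2 * v 0 i3) *: e i4.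

Lemma so3_bracket_rowE (R : realType) (u v : 'rV[R]_4) :
  (so3_bracket u v 0 i1 = 0) *
  (so3_bracket u v 0 i2 = u 0 i4 * v 0 i3 - u 0 i3 * v 0 i4) *
  (so3_bracket u v 0 i3 = u 0 i2 * v 0 i4 - u 0 i4 * v 0 i2) *
  (so3_bracket u v 0 i4 = u 0 i3 * v 0 i2 - u 0 i2 * v 0 i3).
Proof. by rewrite !mxE /=; do ![split]; ring. Qed.

Lemma so3_bracketE (R : realType) (br : 'rV[R]_4 -> 'rV[R]_4 -> 'rV[R]_4) :
  is_lie_bracket br -> (forall u v, br v u = - br u v) ->
  br (e i2) (e i4) = e i3 -> br (e i4) (e i3) = e i2 ->
  br (e i3) (e i2) = e i4 -> (forall i : 'I_4, br (e i1) (e i) = 0) ->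
  forall u v, br u v = so3_bracket u v.
Proof.
move=> br_lie brC br24 br43 br32 br1 u v.
have brDl x y z : br (x + y) z = br x z + br y z.
  by have := br_linear br_lie 1 x y z; rewrite !scale1r.
have br0l z : br 0 z = 0.
  by apply: (@addrI _ (br 0 z)); rewrite -brDl !addr0.
have brZl a x z : br (a *: x) z = a *: br x z.
  by have := br_linear br_lie a x 0 z; rewrite br0l !addr0.
have brDr x y z : br z (x + y) = br z x + br z y.
  by rewrite brC brDl opprD -!brC.
have brZr a x z : br z (a *: x) = a *: br z x.
  by rewrite brC brZl -scalerN -brC.
have br_1 i : br (e i) (e i1) = 0 by rewrite brC br1 oppr0.
have br42 : br (e i4) (e i2) = - e i3 by rewrite brC br24.
have br34 : br (e i3) (e i4) = - e i2 by rewrite brC br43.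
have br23 : br (e i2) (e i3) = - e i4 by rewrite brC br32.
rewrite [u in LHS]row4E [v in LHS]row4E.
rewrite !(brDl, brZl) !(brDr, brZr) !(br_alt br_lie).
rewrite !(br1, br_1, br24, br42, br34, br43, br23, br32).
by apply: row4P; rewrite !mxE /=; ring.
Qed.

(** The solution of Koszul's formula. On e_2, e_3, e_4 the metric has signs (+, -, -), so for u =
    e_2 the three Koszul terms add up to 3 in absolute value instead of partly cancelling. *)
Definition so3_connection (R : realType) (u v : 'rV[R]_4) : 'rV[R]_4 :=
  2^-1 *: ((u 0 i4 * v 0 i3 - u 0 i3 * v 0 i4) *: e i2 +
           (3 * u 0 i2 * v 0 i4 + u 0 i4 * v 0 i2) *: e i3 -
           (3 * u 0 i2 * v 0 i3 + u 0 i3 * v 0 i2) *: e i4).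

Lemma so3_connectionE (R : realType) (u v : 'rV[R]_4) :
  (so3_connection u v 0 i1 = 0) *
  (so3_connection u v 0 i2 = 2^-1 * (u 0 i4 * v 0 i3 - u 0 i3 * v 0 i4)) *
  (so3_connection u v 0 i3 =
     2^-1 * (3 * u 0 i2 * v 0 i4 + u 0 i4 * v 0 i2)) *
  (so3_connection u v 0 i4 =
     - 2^-1 * (3 * u 0 i2 * v 0 i3 + u 0 i3 * v 0 i2)).
Proof. by rewrite !mxE /=; do ![split]; ring. Qed.

(** * Levi-Civita connection, Nijenhuis tensor and structure tensors on the group *)

Section Geometry.
Context {R : realType} (G : lieGroup R 4).
Context (br : 'rV[R]_4 -> 'rV[R]_4 -> 'rV[R]_4).
Context (iota : 'rV[R]_4 -> (G -> R) -> (G -> R)).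
Context (G_lie : is_lie_algebra_of br iota).

(* [is_lie_bracket] asks for linearity in the first argument only, from which
   antisymmetry does not follow; here it comes from the commutator of
   derivations. *)
Lemma lie_bracketC u v : br v u = - br u v.
Proof.
apply/eqP; rewrite -addr_eq0 -[X in X + _]scale1r; apply/eqP.
apply: (iota_inj G_lie) => f sf p.
by rewrite (iota_linear G_lie) // !(iota_bracket G_lie) //; ring.
Qed.

Lemma act_cst x (c : R) p : act iota x (fun=> c) p = 0.
Proof. exact: derivation_cst (iota_deriv G_lie _). Qed.

Lemma vbracket_cst u v p : vbracket br iota (fun=> u) (fun=> v) p = br u v.
Proof.
by apply/rowP => k; rewrite /vbracket !mxE !act_cst subrr addr0.
Qed.

Section Nijenhuis.
Context (J : 'rV[R]_4 -> 'rV[R]_4) (spJ : signed_permutation J).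

Let D u (y : field G) p : 'rV[R]_4 := \row_k iota u (fun q => y q 0 k) p.

Let vbracketE x y p : vbracket br iota x y p =
  br (x p) (y p) + (D (x p) y p - D (y p) x p).
Proof.
by rewrite /vbracket; congr (_ + _); apply/rowP => k; rewrite !mxE.
Qed.

Let D_sperm u y p : smooth_field y -> D u (J \o y) p = J (D u y p).
Proof.
move=> sy; apply/rowP => k; rewrite mxE.
have [m [] Jk] := spJ k; rewrite Jk mxE.
  by congr (iota u _ p); apply/funext => q; rewrite /= Jk.
rewrite -(derivationN _ (iota_deriv G_lie u) (sy m)).
by congr (iota u _ p); apply/funext => q; rewrite /= Jk.
Qed.

(** [J] has constant coefficients, so it commutes with the componentwise derivative [D]; with J^2 =
    -1 all derivative terms cancel and only the algebraic bracket remains. *)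
Lemma nijenhuis_sperm x y p :
  (forall u, J (J u) = - u) -> smooth_field x -> smooth_field y ->
  nijenhuis br iota J x y p = br (J (x p)) (J (y p)) - J (br (J (x p)) (y p))
    - J (br (x p) (J (y p))) - br (x p) (y p).
Proof.
move=> JJ sx sy; rewrite /nijenhuis !vbracketE /= !D_sperm //.
rewrite !(spermD spJ, spermN spJ) !JJ.
by apply/rowP => k; rewrite !mxE; ring.
Qed.

End Nijenhuis.

Context (nabla : field G -> field G -> field G).
Context (nabla_LC : is_levi_civita br iota nabla).

Lemma nabla_cst_metric u v w p :
  g (nabla (fun=> u) (fun=> v) p) w + g v (nabla (fun=> u) (fun=> w) p) = 0.
Proof.
have sc z : smooth_field (fun _ : G => z) by apply: smooth_field_cst.
by rewrite -(nabla_metric nabla_LC (sc u) (sc v) (sc w)) act_cst.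
Qed.

Lemma nabla_cst_torsion u v p :
  nabla (fun=> u) (fun=> v) p = nabla (fun=> v) (fun=> u) p + br u v.
Proof.
have sc z : smooth_field (fun _ : G => z) by apply: smooth_field_cst.
apply/eqP; rewrite addrC -subr_eq.
by rewrite (nabla_torsion_free nabla_LC) // vbracket_cst.
Qed.

Lemma koszul u v w p : 2 * g (nabla (fun=> u) (fun=> v) p) w =
  g (br u v) w - g (br v w) u + g (br w u) v.
Proof.
have muv := nabla_cst_metric u v w p.
have mvw := nabla_cst_metric v w u p.
have mwu := nabla_cst_metric w u v p.
(* Zero torsion leaves three linear equations in the three unknowns g(nabla_v u, w), g(nabla_w v, u)
   and g(nabla_u w, v). *)
rewrite (nabla_cst_torsion u v) gDl (gC v) in muv *.
rewrite (nabla_cst_torsion v w) gDl (gC w) in mvw.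
rewrite (nabla_cst_torsion w u) gDl (gC u) in mwu.
lra.
Qed.

Lemma nabla_at x y p :
  smooth_field x -> smooth_field y -> nabla x y p = nabla (fun=> x p) y p.
Proof.
move=> sx sy; apply: (tensorial_at (T := fun x => nabla x y p)) sx.
  by move=> z z' sz sz'; rewrite (nabla_addl nabla_LC).
by move=> f z sf sz; rewrite (nabla_scalel nabla_LC).
Qed.

(** In [y], the Leibniz terms x(f) J y coming from nabla_x (J y) and from J (nabla_x y) cancel, so F
    is linear over functions there. The argument [z] enters only through its value at [p], so its
    smoothness is not asked for. *)
Lemma F_at (J : 'rV[R]_4 -> 'rV[R]_4) x y z p :
  signed_permutation J -> smooth_field x -> smooth_field y ->
  F nabla J x y z p = F nabla J (fun=> x p) (fun=> y p) (fun=> z p) p.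
Proof.
move=> spJ sx sy; have sc u := @smooth_field_cst _ G u.
have sJ y' : smooth_field y' -> smooth_field (J \o y').
  exact: smooth_field_sperm.
rewrite /F (nabla_at _ sx) ?(nabla_at _ sx sy); last exact: sJ.
congr (g _ _).
pose T y' := nabla (fun=> x p) (J \o y') p - J (nabla (fun=> x p) y' p).
apply: (tensorial_at (T := T)) sy => [y1 y2 s1 s2|f y1 sf s1]; rewrite /T.
  rewrite (_ : J \o _ = fun q => (J \o y1) q + (J \o y2) q); last first.
    by apply/funext => q /=; rewrite (spermD spJ).
  rewrite !(nabla_addr nabla_LC) //; [|exact: sJ..].
  by rewrite (spermD spJ) opprD addrACA.
rewrite (_ : J \o _ = fun q => f q *: (J \o y1) q); last first.
  by apply/funext => q /=; rewrite (spermZ spJ).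
rewrite !(nabla_leibniz nabla_LC) //; last exact: sJ.
by rewrite (spermD spJ) !(spermZ spJ) scalerBr opprD addrACA subrr add0r.
Qed.

Context (br_so3 : forall u v, br u v = so3_bracket u v).

Lemma nabla_cst_so3 u v p :
  nabla (fun=> u) (fun=> v) p = so3_connection u v.
Proof.
(* As g is nondegenerate, its pairings with the frame determine [N], and Koszul's formula supplies
   twice each pairing. *)
set N := nabla _ _ p; suff gN w : g N w = g (so3_connection u v) w.
  apply: row4P.
  - by have := gN (e i1); rewrite !g_e1.
  - by have := gN (e i2); rewrite !g_e2.
  - by have := gN (e i3); rewrite !g_e3 => /oppr_inj.
  - by have := gN (e i4); rewrite !g_e4 => /oppr_inj.
apply: (@mulfI _ 2); first by rewrite pnatr_eq0.
by rewrite koszul !br_so3 /g !so3_connectionE !so3_bracket_rowE; field.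
Qed.

Context (J : 'rV[R]_4 -> 'rV[R]_4) (spJ : signed_permutation J).

Definition so3_F (u v w : 'rV[R]_4) : R :=
  g (so3_connection u (J v) - J (so3_connection u v)) w.

Lemma F_so3 x y z p : smooth_field x -> smooth_field y ->
  F nabla J x y z p = so3_F (x p) (y p) (z p).
Proof. by move=> sx sy; rewrite F_at // /F /so3_F !nabla_cst_so3. Qed.

Lemma theta_so3 z p : theta nabla J z p =
  so3_F (e i1) (e i1) (z p) + so3_F (e i2) (e i2) (z p)
  - so3_F (e i3) (e i3) (z p) - so3_F (e i4) (e i4) (z p).
Proof.
have sc u : smooth_field (fun _ : G => u) by apply: smooth_field_cst.
by rewrite /theta trace_gram !F_so3.
Qed.

End Geometry.

(** * Closed forms of F_1, F_2 and F_3 *)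

Section StructureTensors.
Context {R : realType}.
Implicit Types u v w : 'rV[R]_4.

(** The coefficients are skew in (v, w) because g is Hermitian for J_1; for J_2 and J_3, where g is
    Norden, they are symmetric. *)
Lemma so3_F_J1 u v w : so3_F J1 u v w = 2^-1 *
  (u 0 i3 * (v 0 i1 * w 0 i4 - v 0 i2 * w 0 i3 +
             v 0 i3 * w 0 i2 - v 0 i4 * w 0 i1) -
   u 0 i4 * (v 0 i1 * w 0 i3 + v 0 i2 * w 0 i4 -
             v 0 i3 * w 0 i1 - v 0 i4 * w 0 i2)).
Proof. by rewrite /so3_F /g !(J1E, so3_connectionE, rowBE); field. Qed.

Lemma so3_F_J2 u v w : so3_F J2 u v w = 2^-1 *
  (3 * u 0 i2 * (v 0 i1 * w 0 i4 - v 0 i2 * w 0 i3 -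
                 v 0 i3 * w 0 i2 + v 0 i4 * w 0 i1) -
   2 * u 0 i3 * (v 0 i2 * w 0 i2 + v 0 i4 * w 0 i4) +
   u 0 i4 * (v 0 i1 * w 0 i2 + v 0 i2 * w 0 i1 +
             v 0 i3 * w 0 i4 + v 0 i4 * w 0 i3)).
Proof. by rewrite /so3_F /g !(J2E, so3_connectionE, rowBE); field. Qed.

Lemma so3_F_J3 u v w : so3_F J3 u v w = 2^-1 *
  (3 * u 0 i2 * (v 0 i1 * w 0 i3 + v 0 i2 * w 0 i4 +
                 v 0 i3 * w 0 i1 + v 0 i4 * w 0 i2) +
   u 0 i3 * (v 0 i1 * w 0 i2 + v 0 i2 * w 0 i1 -
             v 0 i3 * w 0 i4 - v 0 i4 * w 0 i3) +
   2 * u 0 i4 * (v 0 i2 * w 0 i2 + v 0 i3 * w 0 i3)).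
Proof. by rewrite /so3_F /g !(J3E, so3_connectionE, rowBE); field. Qed.

End StructureTensors.

Theorem proposition2p1 (R : realType)
  (br : 'rV[R]_4 -> 'rV[R]_4 -> 'rV[R]_4)
  (br_lie : is_lie_bracket br)
  (br24 : br (e i2) (e i4) = e i3)
  (br43 : br (e i4) (e i3) = e i2)
  (br32 : br (e i3) (e i2) = e i4)
  (br1 : forall i : 'I_4, br (e i1) (e i) = 0)
  (G : lieGroup R 4)
  (G_sc : simply_connected R G)
  (iota : 'rV[R]_4 -> (G -> R) -> (G -> R))
  (G_lie : is_lie_algebra_of br iota)
  (nabla : field G -> field G -> field G)
  (nabla_LC : is_levi_civita br iota nabla) :
  class_H br iota nabla /\
  (~ W1 nabla J2 /\ ~ W2 nabla J2) /\
  (~ W1 nabla J3 /\ ~ W2 nabla J3).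
Proof.
have br_so3 := so3_bracketE br_lie (lie_bracketC G_lie) br24 br43 br32 br1.
have sc u : smooth_field (fun _ : G => u) by apply: smooth_field_cst.
have [sp1 sp2 sp3] := And3 (@signed_permutation_J1 R)
  (@signed_permutation_J2 R) (@signed_permutation_J3 R).
have FE J := F_so3 G_lie nabla_LC br_so3 (J := J).
have theta1 z p : theta nabla J1 z p = - z p 0 i2.
  by rewrite (theta_so3 G_lie nabla_LC br_so3) // !so3_F_J1 !mxE /=; field.
have theta2 z p : theta nabla J2 z p = - 2 * z p 0 i3.
  by rewrite (theta_so3 G_lie nabla_LC br_so3) // !so3_F_J2 !mxE /=; field.
have theta3 z p : theta nabla J3 z p = 2 * z p 0 i4.
  by rewrite (theta_so3 G_lie nabla_LC br_so3) // !so3_F_J3 !mxE /=; field.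
split; [split|split; split].
- move=> x y z sx sy sz p; by rewrite FE // !theta1 so3_F_J1 /g !mxE /=; field.
- move=> x y sx sy p; rewrite (nijenhuis_sperm G_lie) //; last first.
    by move=> u; have [] := J_quaternionic u.
  rewrite !br_so3; apply: row4P; rewrite [LHS]rowB3E [RHS]mxE;
    by rewrite !(J2E, so3_bracket_rowE); ring.
- move=> x y sx sy p; rewrite (nijenhuis_sperm G_lie) //; last first.
    by move=> u; have [] := J_quaternionic u.
  rewrite !br_so3; apply: row4P; rewrite [LHS]rowB3E [RHS]mxE;
    by rewrite !(J3E, so3_bracket_rowE); ring.
(* On the right of the W_1 condition only g(e_2, J_2 e_4) theta_2(J_2 e_1) = (-1)(-2) survives, and
   a quarter of it is 1/2. *)
- move=> /(_ _ _ _ (sc (e i2)) (sc (e i1)) (sc (e i4)) (lie_one G)).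
  by rewrite FE // !theta2 so3_F_J2 /g !mxE /=; lra.
- move=> [_ /(_ _ (sc (e i3)) (lie_one G))]; by rewrite theta2 !mxE /=; lra.
(* Likewise only g(e_2, J_3 e_3) theta_3(J_3 e_1) = (-1)(-2) survives here. *)
- move=> /(_ _ _ _ (sc (e i2)) (sc (e i1)) (sc (e i3)) (lie_one G)).
  by rewrite FE // !theta3 so3_F_J3 /g !mxE /=; lra.
- move=> [_ /(_ _ (sc (e i4)) (lie_one G))]; by rewrite theta3 !mxE /=; lra.
Qed.
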